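(* Let $G=\mathrm{GL}_r$, let $\mu=(t_1\cdots t_b)$ be a partition of $r$ with $t_1\ge\cdots\ge t_b>0$ and transpose $\mu^\top$, and let $\lambda=(p_1\cdots p_k)$ be a general partition of $r$ (positive integers with sum $r$, not required to be in non-increasing order). Let $\Phi^+$, $\Phi^-$ be the sets of positive and negative roots of $G$, $\Delta_\lambda$ the set of simple roots contained in $M_\lambda$, $\Phi^-_{\mu^\top}$ the set of negative roots contained in $M_{\mu^\top}$, and $[W(P_{\mu^\top})\backslash W(G)]$ the set of minimal length representatives for $W(P_{\mu^\top})\backslash W(G)$. (1) If there is an index $l$ such that $p_1+\cdots+p_l>t_1+\cdots+t_l$, then for any $w\in[W(P_{\mu^\top})\backslash W(G)]$ there exists $\alpha\in\Delta_\lambda$ such that $w(\alpha)>0$. (2) If $\lambda=\mu$, then there exists a unique $w_\mu\in[W(P_{\mu^\top})\backslash W(G)]$ such that $w_\mu(\alpha)\in\Phi^--\Phi^-_{\mu^\top}$ for all $\alpha\in\Delta_\mu$; and $w(\Delta_\mu)\cap\Phi^+\neq\emptyset$ for all $w\in[W(P_{\mu^\top})\backslash W(G)]$ with $w\ne w_\mu$.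
   Context: Roots are taken with respect to the diagonal torus, positivity with respect to the upper triangular Borel subgroup $B$; $\Delta$ denotes the set of simple roots. The transpose $\mu^\top=(r_1\cdots r_a)$ is given by $r_i=\#\{j:t_j\ge i\}$. For a general partition $\nu=(n_1\cdots n_c)$ of $r$, $P_\nu$ is the standard (block upper triangular) parabolic subgroup with Levi subgroup $M_\nu\cong\mathrm{GL}_{n_1}\times\cdots\times\mathrm{GL}_{n_c}$ (blocks down the diagonal in this order). $W(G)\cong S_r$ is the Weyl group and $W(P_\nu)\subseteq W(G)$ is the Weyl group of $M_\nu$, generated by the simple reflections for the simple roots in $M_\nu$. Each coset $W(P_\nu)w$ contains a unique element of minimal length. Convention: $t_j=0$ for $j>b$. $\Phi^--\Phi^-_{\mu^\top}$ is the set difference. *)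

(* Defs.v *)
From mathcomp Require Import all_boot all_order all_algebra all_fingroup.
Set Implicit Arguments.
Unset Strict Implicit.
Unset Printing Implicit Defensive.
Import GRing.Theory.
Local Open Scope ring_scope.

(** A "general partition" of [r]: positive parts, in any order. *)
Definition is_gpartition (r : nat) (nu : seq nat) : bool :=
  (0%N \notin nu) && (sumn nu == r).

Definition is_partition (r : nat) (nu : seq nat) : bool :=
  is_gpartition r nu && sorted geq nu.

(** Part number [i] (for [i = 1, ..., t_1]) of the transpose of [(t_1 ... t_b)]
    is the number of [j] with [t_j >= i]. *)
Definition transpose (mu : seq nat) : seq nat :=
  [seq count (fun t => i <= t)%N mu | i <- iota 1 (head 0%N mu)].

(** The character lattice of the diagonal torus of GL_r is Z^r;
    [gl_root i j] is the character e_i - e_j, i.e. diag(x) |-> x_i / x_j. *)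
Definition gl_root (r : nat) (i j : 'I_r) : 'rV[int]_r :=
  delta_mx 0 i - delta_mx 0 j.

Section Roots.
Variable r : nat.

(** The root group of e_i - e_j has its nonzero off-diagonal entry at (i, j),
    so it lies in the upper triangular Borel exactly when [i < j]. *)
Definition pos_root : {pred 'rV[int]_r} :=
  [pred a | [exists i : 'I_r, exists j : 'I_r, (i < j)%N && (a == gl_root i j)]].

Definition neg_root : {pred 'rV[int]_r} := [pred a | - a \in pos_root].

Definition simple_root : {pred 'rV[int]_r} :=
  [pred a | [exists i : 'I_r, exists j : 'I_r,
    (j == i.+1 :> nat) && (a == gl_root i j)]].

(** Roots of the block diagonal Levi M_nu: both indices lie in one block.
    [reshape_index nu i] is the number of the block containing [i]. *)
Definition levi_root (nu : seq nat) : {pred 'rV[int]_r} :=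
  [pred a | [exists i : 'I_r, exists j : 'I_r,
    [&& i != j, reshape_index nu i == reshape_index nu j & a == gl_root i j]]].

Definition levi_simple_root (nu : seq nat) : {pred 'rV[int]_r} :=
  [predI simple_root & levi_root nu].

Definition levi_neg_root (nu : seq nat) : {pred 'rV[int]_r} :=
  [predI neg_root & levi_root nu].

(** The action of the Weyl group on characters, with w(e_i) = e_{w i}. *)
Definition weyl_act (w : 'S_r) (a : 'rV[int]_r) : 'rV[int]_r :=
  \row_i a 0 (w^-1%g i).

Lemma weyl_act_gl_root (w : 'S_r) (i j : 'I_r) :
  weyl_act w (gl_root i j) = gl_root (w i) (w j).
Proof.
by apply/rowP => k; rewrite !mxE /= !(canF_eq (permKV w)).
Qed.

(** MathComp composes permutations left to right, [(s * t) x = t (s x)],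
    so the product of Weyl group elements for the action above is reversed. *)
Lemma weyl_actM (v w : 'S_r) (a : 'rV[int]_r) :
  weyl_act (v * w)%g a = weyl_act w (weyl_act v a).
Proof. by apply/rowP => k; rewrite !mxE invMg permM. Qed.

(** The reflection in the root e_i - e_j is the transposition of [i], [j]. *)
Definition reflections (D : {pred 'rV[int]_r}) : {set 'S_r} :=
  [set tperm ij.1 ij.2 | ij : 'I_r * 'I_r & gl_root ij.1 ij.2 \in D].

Definition weyl_parabolic (nu : seq nat) : {set 'S_r} :=
  <<reflections (levi_simple_root nu)>>%g.

Definition is_word (w : 'S_r) (n : nat) : bool :=
  [exists c : {ffun 'I_n -> 'S_r},
    [forall i, c i \in reflections simple_root] && (w == (\prod_i c i)%g)].

Lemma gen_simple_reflections :
  <<reflections simple_root>>%g = [set: 'S_r].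
Proof.
apply/eqP; rewrite eqEsubset subsetT /=; apply/subsetP => s _.
have simP (i j : 'I_r) : j = i.+1 :> nat ->
    tperm i j \in <<reflections simple_root>>%g.
  move=> ij; apply/mem_gen/imsetP; exists (i, j) => //=; rewrite inE /=.
  by apply/existsP; exists i; apply/existsP; exists j; rewrite ij !eqxx.
have adj n (i j : 'I_r) : j = (i + n)%N :> nat ->
    tperm i j \in <<reflections simple_root>>%g.
  elim: n j => [|n IHn] j ij.
    by rewrite (_ : j = i) ?tperm1 ?group1 //; apply/val_inj; rewrite /= ij addn0.
  have lt_r : (i + n < r)%N by rewrite (leq_trans _ (ltn_ord j)) // ij addnS.
  pose k := Ordinal lt_r.
  have [ik|ik] := eqVneq i k.
    by apply: simP; rewrite ij {2}ik /= addnS.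
  have ji : j != i by rewrite -val_eqE /= ij -[eqbRHS]addn0 eqn_add2l.
  rewrite tpermC -(@tpermJ_tperm _ k j i) // 1?eq_sym //.
  by rewrite groupJ 1?[tperm k i]tpermC ?IHn ?simP //= ij addnS.
have [ts -> _] := prod_tpermP s; rewrite group_prod // => -[/= i j] _.
case/orP: (leq_total i j) => [le_ij|le_ji].
  by apply: (adj (j - i)%N); rewrite subnKC.
by rewrite tpermC; apply: (adj (i - j)%N); rewrite subnKC.
Qed.

Lemma ex_word (w : 'S_r) : exists n, is_word w n.
Proof.
have /gen_prodgP[n [c cS ->]] : w \in <<reflections simple_root>>%g.
  by rewrite gen_simple_reflections inE.
exists n; apply/existsP; exists (finfun c); apply/andP; split.
  by apply/forallP => i; rewrite ffunE.
by apply/eqP/eq_bigr => i _; rewrite ffunE.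
Qed.

Definition weyl_length (w : 'S_r) : nat := ex_minn (ex_word w).

(** [W(P_nu)\W(G)]: the elements [w] of minimal length in W(P_nu) w.  Elements
    of that coset act as [w] followed by an element of W(P_nu); in MathComp's
    order of composition this is [w *: W(P_nu)]. *)
Definition min_coset_reps (nu : seq nat) : {set 'S_r} :=
  [set w | [forall v in (w *: weyl_parabolic nu)%g,
             weyl_length w <= weyl_length v]%N].

End Roots.

Arguments pos_root {r}.
Arguments neg_root {r}.
Arguments levi_simple_root {r} nu.
Arguments levi_neg_root {r} nu.
Arguments min_coset_reps r nu : clear implicits.

(* Main.v *)
(* Let f(x) be the number of the block of M_{mu^T} containing w(x). A minimal
   coset representative w has w^-1 increasing on these blocks, hence is determined
   by f; if moreover w makes every root of Delta_lambda negative, then f is strictly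
   decreasing on the blocks of lambda.
   (1) The first l blocks of lambda then meet each fibre of f at most l times, and
   the i-th fibre has r_i elements, so p_1 + ... + p_l is at most
   sum_i min(l, r_i) = t_1 + ... + t_l.
   (2) For lambda = mu, number the cells of the Young diagram of mu row by row. A
   function strictly decreasing along the rows is at least the arm length, whose
   fibres also have r_i elements; comparing sums, f is the arm length. *)

Require Import Defs.
From mathcomp Require Import all_boot all_order all_algebra all_fingroup.
From mathcomp Require Import zify.
Import GRing.Theory.

(** * Roots as pairs of indices *)

Lemma gl_root_inj {r : nat} {i j i' j' : 'I_r} :
  i != j -> gl_root i j = gl_root i' j' -> i = i' /\ j = j'.
Proof.
move=> ij eqR.
have E k : ((k == i)%:R - (k == j)%:R = (k == i')%:R - (k == j')%:R :> int)%R.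
  by move/rowP/(_ k): eqR; rewrite !mxE.
(* The entry 1 at [i] and the entry -1 at [j] pin down the other pair. *)
have := E i; have := E j; rewrite !eqxx (eq_sym j i) (negbTE ij).
by do 4!case: eqVneq => // ?.
Qed.

Lemma pos_root_gl {r : nat} (i j : 'I_r) : (gl_root i j \in pos_root) = (i < j).
Proof.
apply/existsP/idP => [[i' /existsP[j' /andP[lt_ij' /eqP eqR]]]|lt_ij]; last first.
  by exists i; apply/existsP; exists j; rewrite lt_ij eqxx.
have ij' : i' != j' by rewrite -val_eqE neq_ltn lt_ij'.
by have [<- <-] := gl_root_inj ij' (esym eqR).
Qed.

Lemma gl_rootN {r : nat} (i j : 'I_r) : (- gl_root i j)%R = gl_root j i.
Proof. exact: opprB. Qed.

Lemma neg_root_gl {r : nat} (i j : 'I_r) : (gl_root i j \in neg_root) = (j < i).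
Proof. by rewrite inE gl_rootN pos_root_gl. Qed.

Lemma levi_neg_root_gl {r : nat} (nu : seq nat) (i j : 'I_r) :
  (gl_root i j \in levi_neg_root nu)
  = (j < i) && (reshape_index nu i == reshape_index nu j).
Proof.
rewrite inE /= neg_root_gl; case: ltnP => //= lt_ji.
apply/existsP/idP => [[i' /existsP[j' /and3P[ij' eqn /eqP eqR]]]|eqn]; last first.
  exists i; apply/existsP; exists j.
  by rewrite eqn eqxx -val_eqE neq_ltn lt_ji orbT.
by have [<- <-] := gl_root_inj ij' (esym eqR).
Qed.

Lemma levi_simple_rootP {r : nat} {nu : seq nat} {a : 'rV[int]_r} :
  reflect (exists i j : 'I_r, [/\ j = i.+1 :> nat,
             reshape_index nu i = reshape_index nu j & a = gl_root i j])
          (a \in levi_simple_root nu).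
Proof.
apply: (iffP andP) => [[]|[i [j [ji eqn ->]]]].
  case/existsP=> i /existsP[j /andP[/eqP ji /eqP ->]].
  case/existsP=> i' /existsP[j' /and3P[ij' /eqP eqn /eqP eqR]].
  by have [? ?] := gl_root_inj ij' (esym eqR); subst i' j'; exists i, j.
have ij : i != j by rewrite -val_eqE /= ji neq_ltn ltnSn.
split; apply/existsP; exists i; apply/existsP; exists j.
  by rewrite ji !eqxx.
by rewrite ij eqn !eqxx.
Qed.

Lemma simple_reflectionP {r : nat} {c : 'S_r} : c \in reflections (@simple_root r) ->
  exists i j : 'I_r, j = i.+1 :> nat /\ c = tperm i j.
Proof.
case/imsetP=> -[i j] /= ij ->; move: ij; rewrite inE /=.
case/existsP=> i' /existsP[j' /andP[/eqP ji /eqP eqR]].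
have ij' : i' != j' by rewrite -val_eqE /= ji neq_ltn ltnSn.
by have [? ?] := gl_root_inj ij' (esym eqR); subst i' j'; exists i, j.
Qed.

(** * Words in simple reflections and the length function *)

Lemma is_wordP {r : nat} {w : 'S_r} {n : nat} :
  reflect (exists cs : seq 'S_r, [/\ size cs = n,
             {subset cs <= reflections (@simple_root r)} & w = (\prod_(c <- cs) c)%g])
          (is_word w n).
Proof.
apply: (iffP existsP) => [[c /andP[/forallP cS /eqP ->]]|[cs [sz csS ->]]].
  exists (codom c); split; first by rewrite size_codom card_ord.
    by move=> _ /codomP[i ->].
  by rewrite big_map [enum _]enumT [index_enum _]unlock.
subst n; exists [ffun i => tnth (in_tuple cs) i]; apply/andP; split.
  by apply/forallP => i; rewrite ffunE csS ?mem_tnth.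
by rewrite {1}(big_tnth _ _ cs); apply/eqP/eq_bigr => i _; rewrite ffunE.
Qed.

(* Follow the pair (x, y) along the word: its order is reversed at some letter,
   which then has to be the transposition of the current images of x and y, and
   this letter can be deleted. *)
Lemma deletion {r : nat} (cs : seq 'S_r) (x y : 'I_r) :
    {subset cs <= reflections (@simple_root r)} -> x < y ->
    (\prod_(c <- cs) c)%g y < (\prod_(c <- cs) c)%g x ->
  is_word (tperm x y * \prod_(c <- cs) c)%g (size cs).-1.
Proof.
elim: cs x y => [|c cs IHcs] x y csS lt_xy.
  by rewrite big_nil !perm1 => /ltnW; rewrite leqNgt lt_xy.
rewrite big_cons !permM => lt_w.
have csS' : {subset cs <= reflections (@simple_root r)}.
  by move=> d dcs; rewrite csS ?inE ?dcs ?orbT.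
have cS : c \in reflections (@simple_root r) by rewrite csS ?mem_head.
have [lt_c|le_c] := ltnP (c x) (c y).
  have /is_wordP[ds [szd dsS eqd]] := IHcs _ _ csS' lt_c lt_w.
  have cs_gt0 : 0 < size cs.
    by case: (cs) lt_w => // ; rewrite big_nil !perm1 => /ltnW; rewrite leqNgt lt_c.
  apply/is_wordP; exists (c :: ds); split; first by rewrite /= szd prednK.
    by move=> d; rewrite inE => /predU1P[->|/dsS].
  by rewrite big_cons -eqd !mulgA -(tpermJ x y c) conjgE !mulgA mulgV mul1g.
have [i [j [ji ec]]] := simple_reflectionP cS.
apply/is_wordP; exists cs; split => //.
suff [-> ->] : x = i /\ y = j by rewrite ec mulgA tperm2 mul1g.
have [] : val x = val i /\ val y = val j; last by move=> /val_inj-> /val_inj->.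
move: le_c lt_xy; rewrite ec.
case: tpermP => [->|->|/eqP + /eqP]; case: tpermP => [->|->|/eqP + /eqP];
  rewrite -?val_eqE /=; lia.
Qed.

(** Apply [deletion] to a shortest word of [w] and the preimages of [i] and [j]: conjugating by [w]
    turns the transposition of the preimages into [tperm i j]. *)
Lemma weyl_length_mulr_tperm {r : nat} (w : 'S_r) (i j : 'I_r) :
  i < j -> (w^-1%g j < w^-1%g i) -> weyl_length (w * tperm i j)%g < weyl_length w.
Proof.
move=> lt_ij lt_w; rewrite /weyl_length.
case: ex_minnP => m _ min_m; case: ex_minnP => n /is_wordP[cs [<- csS ew]] _.
have := @deletion _ cs (w^-1%g j) (w^-1%g i) csS lt_w.
rewrite -ew !permKV => /(_ lt_ij) wd.
have eqw : (tperm (w^-1 j) (w^-1 i) * w = w * tperm i j)%g.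
  by rewrite (conjgC _ w) tpermJ !permKV tpermC.
rewrite eqw in wd; apply: leq_ltn_trans (min_m _ wd) _.
(* The empty word reverses no pair, so deleting a letter does lower the size. *)
case: (cs) ew => [|//] ew; move: lt_w.
by rewrite ew big_nil invg1 !perm1 => /ltnW; rewrite leqNgt lt_ij.
Qed.

(** * Blocks and minimal coset representatives *)

Lemma reshape_index_mono (nu : seq nat) :
  {homo reshape_index nu : i j / i <= j}.
Proof. by move=> i j; rewrite (reshape_leq nu) => /orP[/ltnW|/andP[/eqP->]]. Qed.

(** Blocks are intervals, so the steps between neighbours from [i] to [j] stay in one block and
    chain by transitivity. *)
Lemma block_homo {r : nat} (nu : seq nat) (R : rel nat) (h : 'I_r -> nat) :
    transitive R ->
    (forall i j : 'I_r, j = i.+1 :> nat ->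
       reshape_index nu i = reshape_index nu j -> R (h i) (h j)) ->
  forall i j : 'I_r, i < j ->
    reshape_index nu i = reshape_index nu j -> R (h i) (h j).
Proof.
move=> Rtr Radj i j lt_ij.
have [n] := ubnP j; elim: n j lt_ij => // n IHn j lt_ij lt_jn eqij.
have [ji|ji] := eqVneq (j : nat) i.+1; first exact: Radj.
have lt_kr : j.-1 < r by have := ltn_ord j; lia.
pose k := Ordinal lt_kr.
have lt_ik : i < k by rewrite /=; lia.
have eqik : reshape_index nu i = reshape_index nu k.
  apply/eqP; rewrite eqn_leq reshape_index_mono ?(ltnW lt_ik) //= eqij.
  by rewrite reshape_index_mono //= leq_pred.
apply: (Rtr (h k)); first by apply: IHn => //=; lia.
by apply: Radj; rewrite -?eqik //=; lia.
Qed.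

Lemma weyl_parabolic_index {r : nat} {nu : seq nat} {v : 'S_r} (x : 'I_r) :
  v \in weyl_parabolic r nu -> reshape_index nu (v x) = reshape_index nu x.
Proof.
case/gen_prodgP=> n [c cS ->].
elim/big_rec: _ x => [|i s _ IHs] x; first by rewrite perm1.
rewrite permM IHs; have /imsetP[[a b] /= ab ->] := cS i.
move: ab; rewrite inE => /levi_simple_rootP[a' [b' [ba eqn eqR]]].
have ab' : a' != b' by rewrite -val_eqE /= ba neq_ltn ltnSn.
have [? ?] := gl_root_inj ab' (esym eqR); subst a' b'.
by case: tpermP => [->|->|].
Qed.

(** A descent of [w^-1] at neighbours of one block could be removed by their simple reflection,
    which shortens [w] within its coset. *)
Lemma min_coset_reps_increasing {r : nat} {nu : seq nat} {w : 'S_r} :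
    w \in min_coset_reps r nu ->
  forall i j : 'I_r, i < j ->
    reshape_index nu i = reshape_index nu j -> w^-1%g i < w^-1%g j.
Proof.
rewrite inE => /forall_inP minw.
apply: (@block_homo _ nu ltn (fun i => w^-1%g i)) => [|i j ji eqn].
  exact: ltn_trans.
have lt_ij : i < j by rewrite ji.
rewrite /= ltn_neqAle leqNgt; apply/andP; split.
  by rewrite val_eqE (inj_eq perm_inj) -val_eqE neq_ltn lt_ij.
apply/negP => /(weyl_length_mulr_tperm w i j lt_ij); rewrite ltnNge minw //.
rewrite mem_lcoset mulKg; apply/mem_gen/imsetP; exists (i, j) => //=.
by rewrite inE; apply/levi_simple_rootP; exists i, j.
Qed.

(** Any shortest element of the coset of [u] serves, since the parabolic subgroup preserves
    blocks. *)
Lemma ex_min_coset_rep {r : nat} (nu : seq nat) (u : 'S_r) :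
  exists2 w, w \in min_coset_reps r nu &
    forall x, reshape_index nu (w x) = reshape_index nu (u x).
Proof.
have u_in : u \in (u *: weyl_parabolic r nu)%g by rewrite mem_lcoset mulVg group1.
case: (@arg_minnP _ u [in (u *: weyl_parabolic r nu)%g] (@weyl_length r) u_in) => w.
case/lcosetP=> v vP -> minw; exists (u * v)%g => [|x]; last first.
  by rewrite permM (weyl_parabolic_index _ vP).
rewrite inE; apply/forall_inP => t tP; apply: minw.
move: tP; rewrite !mem_lcoset invMg -mulgA => /(groupM vP).
by rewrite mulKVg.
Qed.

Lemma min_coset_rep_eq {r : nat} {nu : seq nat} {w w' : 'S_r} :
    w \in min_coset_reps r nu -> w' \in min_coset_reps r nu ->
    (forall x, reshape_index nu (w x) = reshape_index nu (w' x)) ->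
  w = w'.
Proof.
pose f (u : 'S_r) x := reshape_index nu (u x).
(* A minimal representative is recovered from its block assignment. *)
have ltE u : u \in min_coset_reps r nu -> forall x y : 'I_r,
    (u x < u y) = (f u x < f u y) || (f u x == f u y) && (x < y).
  move=> uP x y; have inc := min_coset_reps_increasing uP.
  have [lt_f|lt_f|eq_f] := ltngtP (f u x) (f u y).
  - by rewrite ltnNge; apply/negP => /(reshape_index_mono nu); rewrite leqNgt lt_f.
  - apply/negbTE/negP => /ltnW /(reshape_index_mono nu).
    by rewrite leqNgt lt_f.
  - have [lt_u|lt_u|eq_u] := ltngtP (u x) (u y).
    + by have := inc _ _ lt_u eq_f; rewrite !permK => ->.
    + have := inc _ _ lt_u (esym eq_f); rewrite !permK => /ltnW.
      by rewrite leqNgt => /negbTE.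
    + by move/val_inj/perm_inj: eq_u => ->; rewrite ltnn.
(* By [ltE] the relative order of the values depends only on the block assignment; counting smaller
   values recovers [u x] from this order. *)
have rankE (u : 'S_r) (x : 'I_r) : u x = #|[set y | u y < u x]| :> nat.
  rewrite -(card_imset _ (@perm_inj _ u)).
  have -> : u @: [set y | u y < u x] = [set z : 'I_r | z < u x].
    apply/setP => z; rewrite inE; apply/imsetP/idP => [[y + ->]|lt_z].
      by rewrite inE.
    by exists (u^-1%g z); rewrite ?inE permKV.
  rewrite cardsE -sum1_card (big_ord_narrow (ltnW (ltn_ord (u x)))) /=.
  by rewrite sum1_card card_ord.
move=> wP w'P eqf; apply/permP => x; apply: val_inj; rewrite /= rankE [RHS]rankE.
by apply: eq_card => y; rewrite !inE !ltE // /f !eqf.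
Qed.

Lemma ascent_or_descending {r : nat} (nu : seq nat) (w : 'S_r) :
  (exists2 a : 'rV[int]_r, a \in levi_simple_root nu & weyl_act w a \in pos_root)
  \/ (forall i j : 'I_r, j = i.+1 :> nat ->
        reshape_index nu i = reshape_index nu j -> w j < w i).
Proof.
case: (boolP [exists i : 'I_r, exists j : 'I_r, [&& j == i.+1 :> nat,
        reshape_index nu i == reshape_index nu j & w i < w j]]) => [|noasc].
  case/existsP=> i /existsP[j /and3P[/eqP ji /eqP eqn lt_w]]; left.
  exists (gl_root i j); first by apply/levi_simple_rootP; exists i, j.
  by rewrite weyl_act_gl_root pos_root_gl.
right=> i j ji eqn; rewrite ltn_neqAle leqNgt; apply/andP; split.
  by rewrite val_eqE (inj_eq perm_inj) -val_eqE /= ji neq_ltn ltnSn orbT.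
apply: contra noasc => lt_w; apply/existsP; exists i; apply/existsP; exists j.
by rewrite eqn lt_w -ji !eqxx.
Qed.

(* Within a block of nu the representative w^-1 increases, so two points of a
   lam-block, which w puts in decreasing order, cannot share a block of nu. *)
Lemma block_index_decreasing {r : nat} {nu lam : seq nat} {w : 'S_r} :
    w \in min_coset_reps r nu ->
    (forall i j : 'I_r, j = i.+1 :> nat ->
       reshape_index lam i = reshape_index lam j -> w j < w i) ->
  forall i j : 'I_r, i < j -> reshape_index lam i = reshape_index lam j ->
    reshape_index nu (w j) < reshape_index nu (w i).
Proof.
move=> wP wdesc i j lt_ij eql.
have lt_w : w j < w i.
  apply: (@block_homo _ lam (fun m n => n < m) (fun i => w i)) => //.
  by move=> a b c ab bc; apply: ltn_trans bc ab.
rewrite ltn_neqAle reshape_index_mono ?(ltnW lt_w) // andbT.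
apply/eqP => /(min_coset_reps_increasing wP _ _ lt_w); rewrite !permK => /ltnW.
by rewrite leqNgt lt_ij.
Qed.

(** * Counting cells of a Young diagram by rows and by columns *)

Lemma card_le_inj {T : finType} (A : {set T}) (h : T -> nat) (n : nat) :
  {in A &, injective h} -> (forall x, x \in A -> h x < n) -> #|A| <= n.
Proof.
move=> h_inj h_lt; rewrite -(size_iota 0 n) cardE -(size_map h).
apply: uniq_leq_size.
  by rewrite map_inj_in_uniq ?enum_uniq // => x y; rewrite !mem_enum; apply: h_inj.
by move=> _ /mapP[x xA ->]; rewrite mem_iota h_lt // -mem_enum.
Qed.

Lemma all_geq_head (mu : seq nat) : sorted geq mu -> all (geq (head 0 mu)) mu.
Proof.
case: mu => //= t s ts; rewrite leqnn; apply: order_path_min ts.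
by move=> a b c ab bc; apply: leq_trans bc ab.
Qed.

(** In a non-increasing list the parts exceeding [i] form a prefix. *)
Lemma count_gt_take (mu : seq nat) (l i : nat) : sorted geq mu ->
  count (ltn i) (take l mu) = minn l (count (ltn i) mu).
Proof.
elim: mu l => [|t s IHs] [|l] //= ts; rewrite ?minn0 ?min0n //.
rewrite IHs ?(path_sorted ts) //; have [lt_it|le_ti] := ltnP i t.
  by rewrite !add1n minnSS.
rewrite !add0n (_ : count _ s = 0) ?minn0 //.
apply/eqP; rewrite -leqn0 leqNgt -has_count; apply/hasPn => u us /=.
have /andP[_ /allP/(_ u us) le_ut] := all_geq_head (t :: s) ts.
by rewrite -leqNgt (leq_trans le_ut).
Qed.

(** Positions count from 0, so position [i] holds r_(i+1), whence the strict inequality; beyond the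
    first part of [mu] the default 0 is the true count. *)
Lemma nth_transpose (mu : seq nat) (i : nat) :
  sorted geq mu -> nth 0 (transpose mu) i = count (ltn i) mu.
Proof.
move=> mu_s; rewrite /transpose; have [lt_i|le_i] := ltnP i (head 0 mu).
  by rewrite (nth_map 0) ?size_iota // nth_iota // add1n.
rewrite nth_default ?size_map ?size_iota //; symmetry.
have := count_gt_take mu 1 i mu_s.
case: mu mu_s le_i => //= t s _; rewrite take0 /= addn0 ltnNge => -> /=; lia.
Qed.

(** Double counting: a part [t] contributes 1 for each [i < t], and [h] bounds all parts. *)
Lemma sum_count_gt (s : seq nat) (h : nat) : all (geq h) s ->
  \sum_(i < h) count (ltn i) s = sumn s.
Proof.
elim: s => [_|t s IHs /= /andP[le_th /IHs <-]]; first by rewrite big1.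
rewrite big_split /=; congr (_ + _).
rewrite -(big_mkord predT (fun i => nat_of_bool (i < t))).
rewrite (big_cat_nat (n := t)) //=.
rewrite (eq_big_nat _ _ (F2 := fun=> 1)) => [|i /andP[_ ->] //].
rewrite sum_nat_const_nat subn0 muln1 big_nat_cond big1 ?addn0 // => i.
by rewrite andbT => /andP[le_ti _]; rewrite ltnNge le_ti.
Qed.

Lemma sumn_transpose (mu : seq nat) :
  sorted geq mu -> sumn (transpose mu) = sumn mu.
Proof.
move=> mu_s; rewrite sumnE (big_nth 0) big_mkord size_map size_iota.
by under eq_bigr do rewrite nth_transpose //; rewrite sum_count_gt ?all_geq_head.
Qed.

(** The default 0 of [nth] is the convention t_j = 0 past the end. *)
Lemma sum_nth_take (s : seq nat) (l : nat) :
  \sum_(j < l) nth 0 s j = sumn (take l s).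
Proof.
elim: s l => [|t s IHs] [|l] /=; rewrite ?big_ord0 //.
  by rewrite big1 // => i _; rewrite nth_nil.
by rewrite big_ord_recl /= IHs.
Qed.

(** * The inequality behind (1) *)

Lemma reshape_index_lt_take (nu : seq nat) (l x : nat) :
  x < sumn (take l nu) -> reshape_index nu x < l.
Proof.
rewrite !ltnNge; apply: contra => le_l.
rewrite -(reshape_indexK nu x) /flatten_index (leq_trans _ (leq_addr _ _)) //.
rewrite -[take l nu](take_takel _ le_l) -{2}(cat_take_drop l (take _ nu)).
by rewrite sumn_cat leq_addr.
Qed.

Lemma sum_take_le {r : nat} (mu lam : seq nat) (w : 'S_r) (l : nat) :
    is_partition r mu -> is_gpartition r lam ->
    (forall i j : 'I_r, i < j -> reshape_index lam i = reshape_index lam j ->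
       reshape_index (transpose mu) (w j) < reshape_index (transpose mu) (w i)) ->
  \sum_(j < l) nth 0 lam j <= \sum_(j < l) nth 0 mu j.
Proof.
case/andP=> /andP[_ /eqP sum_mu] mu_s /andP[_ /eqP sum_lam] fdec.
rewrite !sum_nth_take; set n := sumn (take l lam).
pose f x := reshape_index (transpose mu) (w x).
have f_lt x : f x < head 0 mu.
  rewrite -[X in _ < X](size_iota 1).
  rewrite -(size_map (fun i => count (fun t => i <= t) mu)).
  by rewrite reshape_indexP // sumn_transpose // sum_mu.
have le_nr : n <= r.
  by rewrite -sum_lam -[X in sumn X](cat_take_drop l lam) sumn_cat leq_addr.
have <- : #|[set x : 'I_r | x < n]| = n.
  by rewrite cardsE -sum1_card (big_ord_narrow le_nr) /= sum1_card card_ord.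
(* Split the points of the first [l] blocks of [lam] into fibres of [f], and the first [l] rows of
   the diagram of [mu] into columns, then compare termwise. *)
rewrite -sum1_card (partition_big (fun x => Ordinal (f_lt x)) predT) //=.
rewrite -(sum_count_gt (take l mu) (head 0 mu)); last first.
  by apply/allP => t /mem_take; apply/allP/all_geq_head.
apply: leq_sum => i _; rewrite count_gt_take // -nth_transpose //.
set A := [set x : 'I_r | (x < n) && (f x == i)].
rewrite (eq_bigl (fun x => x \in A)) ?sum1_card; last by move=> x; rewrite !inE.
rewrite leq_min; apply/andP; split.
  (* Bound by [l]: two points of one block of [lam] have different values of [f]. *)
  apply: (card_le_inj A (fun x : 'I_r => reshape_index lam x)) => [x y|x]; rewrite !inE.
    move=> /andP[_ /eqP fx] /andP[_ /eqP fy] eql.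
    have [lt_xy|lt_yx|/val_inj //] := ltngtP x y.
      by have := fdec _ _ lt_xy eql; rewrite -!/(f _) fx fy ltnn.
    by have := fdec _ _ lt_yx (esym eql); rewrite -!/(f _) fx fy ltnn.
  by case/andP=> /reshape_index_lt_take.
(* Bound by the column length: [w] sends the fibre injectively into block [i] of the transpose,
   where the offset determines the point. *)
apply: (card_le_inj A (fun x : 'I_r => reshape_offset (transpose mu) (w x))) => [x y|x].
  rewrite !inE => /andP[_ /eqP fx] /andP[_ /eqP fy] eqo.
  apply/(@perm_inj _ w)/val_inj => /=.
  by rewrite -(reshape_indexK (transpose mu) (w x)) -/(f x) fx eqo -fy reshape_indexK.
rewrite inE => /andP[_ /eqP <-]; apply: reshape_offsetP.
by rewrite sumn_transpose // sum_mu.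
Qed.

(** * Arm lengths and the representative of (2) *)

(* The points of 'I_r number the cells of the Young diagram of mu row by row;
   this is the number of cells to the right of x in its row. *)
Definition arm (mu : seq nat) (x : nat) : nat :=
  nth 0 mu (reshape_index mu x) - (reshape_offset mu x).+1.

(** Induction on the arm: one step to the right lowers the arm by exactly 1 and [f] by at least
    1. *)
Lemma arm_le_decreasing {r : nat} {mu : seq nat} {f : 'I_r -> nat} :
    sumn mu = r ->
    (forall i j : 'I_r, i < j -> reshape_index mu i = reshape_index mu j ->
       f j < f i) ->
  forall x : 'I_r, arm mu x <= f x.
Proof.
move=> sum_mu fdec x; move En : (arm mu x) => n.
elim: n x En => // n IHn x En.
have lt_o : (reshape_offset mu x).+1 < nth 0 mu (reshape_index mu x).
  by move: En; rewrite /arm; lia.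
have eSx : x.+1 = flatten_index mu (reshape_index mu x) (reshape_offset mu x).+1.
  by rewrite -{1}(reshape_indexK mu x) /flatten_index addnS.
have lt_Sx : x.+1 < r by rewrite eSx -[X in _ < X]sum_mu flatten_indexP.
have eqi : reshape_index mu x.+1 = reshape_index mu x.
  by rewrite {1}eSx flatten_indexKl.
apply: leq_ltn_trans (fdec x (Ordinal lt_Sx) (ltnSn _) (esym eqi)); apply: IHn.
rewrite /arm /= eqi eSx flatten_indexKr //.
by move: En; rewrite /arm; lia.
Qed.

(** If row [j] reaches column [i], so do all the rows above it. *)
Lemma lt_count_gt (mu : seq nat) (i j : nat) :
  sorted geq mu -> i < nth 0 mu j -> j < count (ltn i) mu.
Proof.
elim: mu j => [|t s IHs] j /= ts; first by rewrite nth_nil.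
case: j => [->|j lt_i] //=.
have lt_j : j < size s.
  by rewrite ltnNge; apply: contraL lt_i => ?; rewrite nth_default.
have /andP[_ /allP/(_ _ (mem_nth 0 lt_j)) le_t] := all_geq_head (t :: s) ts.
by rewrite (leq_trans lt_i le_t) add1n ltnS IHs // (path_sorted ts).
Qed.

(** Reverse each row and number the cells column by column: the cell of row [k] with arm [a] goes to
    position [k] of column [a]. *)
Lemma ex_arm_perm {r : nat} (mu : seq nat) : is_partition r mu ->
  exists u : 'S_r, forall x, reshape_index (transpose mu) (u x) = arm mu x.
Proof.
case/andP=> /andP[_ /eqP sum_mu] mu_s.
have lt_o (x : 'I_r) : reshape_offset mu x < nth 0 mu (reshape_index mu x).
  by rewrite reshape_offsetP // sum_mu.
have lt_i (x : 'I_r) : reshape_index mu x < nth 0 (transpose mu) (arm mu x).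
  rewrite nth_transpose // lt_count_gt // /arm; have := lt_o x; lia.
have u_lt (x : 'I_r) : flatten_index (transpose mu) (arm mu x) (reshape_index mu x) < r.
  by rewrite -[X in _ < X]sum_mu -sumn_transpose // flatten_indexP.
have u_inj : injective (fun x => Ordinal (u_lt x)).
  move=> x y /(congr1 val) /= eq_u.
  have eqi : reshape_index mu x = reshape_index mu y.
    by rewrite -(flatten_indexKr (lt_i x)) eq_u flatten_indexKr.
  have eqa : arm mu x = arm mu y.
    by rewrite -(flatten_indexKl (lt_i x)) eq_u flatten_indexKl.
  apply: val_inj; rewrite /= -(reshape_indexK mu x) -[RHS](reshape_indexK mu y) eqi.
  congr flatten_index; have := lt_o x; have := lt_o y; move: eqa.
  by rewrite /arm eqi; lia.
by exists (perm u_inj) => x; rewrite permE /= flatten_indexKl.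
Qed.

(* arm is the smallest function decreasing along the rows, and the sum of
   the block numbers over all points does not depend on w. *)
Lemma index_eq_arm {r : nat} {mu : seq nat} {w : 'S_r} :
    is_partition r mu ->
    (forall i j : 'I_r, i < j -> reshape_index mu i = reshape_index mu j ->
       reshape_index (transpose mu) (w j) < reshape_index (transpose mu) (w i)) ->
  forall x, reshape_index (transpose mu) (w x) = arm mu x.
Proof.
move=> muP wdec x; have [u uE] := ex_arm_perm mu muP.
have /andP[/andP[_ /eqP sum_mu] _] := muP.
have le_arm (y : 'I_r) : arm mu y <= reshape_index (transpose mu) (w y) ?= iff
                  (arm mu y == reshape_index (transpose mu) (w y)).
  split=> //.
  exact: (arm_le_decreasing
            (f := fun y : 'I_r => reshape_index (transpose mu) (w y)) sum_mu).
have [_] := leqif_sum (P := predT) (fun y _ => le_arm y).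
under eq_bigr do rewrite -uE.
pose F (y : 'I_r) := reshape_index (transpose mu) y.
rewrite -(reindex_inj (P := predT) (F := F) (@perm_inj _ u)).
rewrite -(reindex_inj (P := predT) (F := F) (@perm_inj _ w)) eqxx.
by move/esym/forallP/(_ x) => /= /eqP.
Qed.

Theorem theorem1p3 (r : nat) (mu lam : seq nat)
    (hmu : is_partition r mu) (hlam : is_gpartition r lam) :
  ((exists l : nat, (1 <= l <= size lam)%N /\
      (\sum_(j < l) nth 0 lam j > \sum_(j < l) nth 0 mu j)%N) ->
    forall w : 'S_r, w \in min_coset_reps r (transpose mu) ->
      exists2 a : 'rV[int]_r,
        a \in levi_simple_root lam & weyl_act w a \in pos_root)
  /\
  (lam = mu ->
    exists w_mu : 'S_r,
      unique (fun w : 'S_r =>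
        w \in min_coset_reps r (transpose mu) /\
        forall a : 'rV[int]_r, a \in levi_simple_root mu ->
          weyl_act w a \in [predD neg_root & levi_neg_root (transpose mu)]) w_mu
      /\
      forall w : 'S_r, w \in min_coset_reps r (transpose mu) -> w <> w_mu ->
        exists2 a : 'rV[int]_r,
          a \in levi_simple_root mu & weyl_act w a \in pos_root).
Proof.
split=> [[l [_ lt_sum]] w wP|_].
  have [//|/(block_index_decreasing wP) wdec] := ascent_or_descending lam w.
  by have := sum_take_le mu lam w l hmu hlam wdec; rewrite leqNgt lt_sum.
have [u uE] := ex_arm_perm mu hmu.
(* [u] itself may fail to be minimal in its coset; passing to a shortest element keeps the block
   assignment. *)
have [w_mu w_muP eq_u] := ex_min_coset_rep (transpose mu) u.
have w_muE x : reshape_index (transpose mu) (w_mu x) = arm mu x by rewrite eq_u uE.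
have uniq_w w : w \in min_coset_reps r (transpose mu) ->
    (forall i j : 'I_r, j = i.+1 :> nat ->
       reshape_index mu i = reshape_index mu j -> w j < w i) -> w = w_mu.
  move=> wP /(block_index_decreasing wP) /(index_eq_arm hmu) wE.
  by apply: min_coset_rep_eq wP w_muP _ => x; rewrite wE w_muE.
exists w_mu; split; last first.
  by move=> w wP; have [//|/(uniq_w w wP)] := ascent_or_descending mu w.
split.
  split=> // _ /levi_simple_rootP[i [j [ji eqi ->]]]; rewrite weyl_act_gl_root.
  (* [j] is the cell to the right of [i] in the same row, so its arm is smaller by 1. *)
  have lt_f :
      reshape_index (transpose mu) (w_mu j) < reshape_index (transpose mu) (w_mu i).
    have /andP[/andP[_ /eqP sum_mu] _] := hmu.
    have := reshape_offsetP (sh := mu) (i := j); rewrite sum_mu ltn_ord => /(_ isT).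
    have := reshape_indexK mu i; have := reshape_indexK mu j.
    by rewrite !w_muE /arm /flatten_index -eqi ji; lia.
  (* A smaller block number forces a smaller value, so the image is negative; as the blocks differ,
     it lies outside the Levi. *)
  have lt_w : w_mu j < w_mu i.
    by rewrite ltnNge; apply: contraL lt_f => ?; rewrite -leqNgt reshape_index_mono.
  by rewrite inE /= neg_root_gl levi_neg_root_gl lt_w eq_sym (ltn_eqF lt_f).
move=> w [wP wneg]; apply/esym/uniq_w => // i j ji eqi.
have ijP : gl_root i j \in levi_simple_root mu by apply/levi_simple_rootP; exists i, j.
by have /andP[_] := wneg _ ijP; rewrite /= weyl_act_gl_root neg_root_gl.
Qed.
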